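(* Let $f=f(x,y,p)$ and $h=h(x,y)$ be two smooth functions and $L=2\varrho\frac{\partial^2}{\partial\varrho^2}-3\frac{\partial}{\partial\varrho}-\tfrac18\frac{\partial^2}{\partial p^2}$. Consider for functions $A,B,C$ of $(x,y,p,\varrho)$ the second order system $$\begin{aligned}LA&=\tfrac9{40}f_{pppp},\\ LB&=-\tfrac1{36}A_p+\tfrac3{40}f_{ppp}+\tfrac9{20}h_y,\\ LC&=-\tfrac1{18}B_p+\tfrac1{324}A+\tfrac1{30}f_{pp}-\tfrac2{15}h^2+\tfrac15(ph_y+h_x),\end{aligned}\qquad(\mathrm{II})$$ and the first order system $$\begin{aligned}B_p&=\tfrac59A-\tfrac29\varrho A_\varrho,\\ B_\varrho&=-\tfrac1{72}A_p-\tfrac1{40}f_{ppp}-\tfrac3{20}h_y,\\ C_\varrho&=\tfrac1{648}A-\tfrac1{72}B_p-\tfrac1{90}f_{pp}+\tfrac2{45}h^2-\tfrac1{15}(ph_y+h_x),\\ C_p&=\tfrac1{324}\varrho A_p+\tfrac23B+\tfrac1{180}\varrho f_{ppp}+\tfrac1{30}\varrho h_y.\end{aligned}\qquad(\mathrm I)$$ Then the formal power series solutions $A=\sum_{k\ge1}a_k\varrho^k$, $B=\sum_{k\ge1}b_k\varrho^k$, $C=\sum_{k\ge1}c_k\varrho^k$ (with coefficients functions of $(x,y,p)$) of the second order system (II) solve the first order system (I). Moreover, twice differentiable solutions $A,B,C$ of the first order system (I) are solutions to the second order system (II).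
   Context: Subscripts denote partial derivatives. *)

(* Defs.v *)
From HB Require Import structures.
From mathcomp Require Import all_boot all_order all_algebra.
From mathcomp Require Import boolp classical_sets functions reals topology.
From mathcomp Require Import normedtype derive.

Set Implicit Arguments.
Unset Strict Implicit.
Unset Printing Implicit Defensive.
Import Order.TTheory GRing.Theory Num.Theory.
Import numFieldNormedType.Exports.

Local Open Scope classical_set_scope.
Local Open Scope ring_scope.

(* Points are row vectors with coordinates (x, y, p, rho), in this order, or an
   initial segment of them: h lives on 'rV_2, f on 'rV_3, and A, B, C on
   'rV_4. *)

Definition evec (R : realType) (n : nat) (i : 'I_n) : 'rV[R]_n := delta_mx 0 i.

Definition pd (R : realType) (n : nat) (i : 'I_n) (g : 'rV[R]_n -> R) :
    'rV[R]_n -> R :=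
  fun v => 'D_(evec R i) g v.

(* On an open set, a function is m times (Frechet) differentiable iff all its
   iterated partial derivatives of order < m are differentiable. *)
Definition differentiable_upto (R : realType) (n m : nat) (U : set 'rV[R]_n)
    (g : 'rV[R]_n -> R) : Prop :=
  forall s : seq 'I_n, (size s < m)%N ->
  forall v, U v -> differentiable (foldr (@pd R n) g s) v.

Definition smooth_on (R : realType) (n : nat) (U : set 'rV[R]_n)
    (g : 'rV[R]_n -> R) : Prop :=
  forall m, differentiable_upto m U g.

Definition forget_last (R : realType) (n : nat) (v : 'rV[R]_n.+1) : 'rV[R]_n :=
  \row_(i < n) v 0 (widen_ord (leqnSn n) i).

(* Both systems are read in two settings: for genuine functions of
   (x, y, p, rho), and for formal power series in rho with coefficients
   functions of (x, y, p).  A setting provides exactly what is needed to write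
   them: the embedding of the functions of (x, y, p), the multiplication by
   rho, the two partial derivatives, and the meaning of an equation, which is
   imposed on the domain under consideration only. *)
Record setting (R : realType) := Setting {
  carrier : lmodType R;
  emb : ('rV[R]_3 -> R) -> carrier;
  mulrho : carrier -> carrier;
  d_p : carrier -> carrier;
  d_rho : carrier -> carrier;
  equ : carrier -> carrier -> Prop
}.

Definition functions_on (R : realType) (W : set 'rV[R]_4) : setting R :=
  @Setting R ('rV[R]_4 -> R)
    (fun phi w => phi (forget_last w))
    (fun A w => w 0 (inord 3) * A w)
    (pd (inord 2))
    (pd (inord 3))
    (fun A B => forall w, W w -> A w = B w).

(* a : nat -> 'rV_3 -> R stands for \sum_k (a k) rho^k. *)
Definition series_on (R : realType) (U : set 'rV[R]_3) : setting R :=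
  @Setting R (nat -> 'rV[R]_3 -> R)
    (fun phi k => if k is 0%N then phi else 0)
    (fun a k => if k is k'.+1 then a k' else 0)
    (fun a k => pd (inord 2) (a k))
    (fun a k => k.+1%:R *: a k.+1)
    (fun a b => forall k v, U v -> a k v = b k v).

Section Systems.
Context (R : realType) (S : setting R).
Implicit Types (f : 'rV[R]_3 -> R) (h : 'rV[R]_2 -> R) (A B C : carrier S).

Definition opL (A : carrier S) : carrier S :=
  2 *: mulrho (d_rho (d_rho A)) - 3 *: d_rho A - (1 / 8) *: d_p (d_p A).

Definition fp f (k : nat) : carrier S := emb S (iter k (pd (inord 2)) f).

Definition h_sq h : carrier S := emb S (fun v => h (forget_last v) ^+ 2).

Definition h_y h : carrier S :=
  emb S (fun v => pd (inord 1) h (forget_last v)).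

(* p h_y + h_x *)
Definition ph_y_h_x h : carrier S :=
  emb S (fun v => v 0 (inord 2) * pd (inord 1) h (forget_last v)
                  + pd (inord 0) h (forget_last v)).

Definition systemII f h A B C : Prop :=
  [/\ equ (opL A) ((9 / 40) *: fp f 4),
      equ (opL B)
        (- (1 / 36) *: d_p A + (3 / 40) *: fp f 3 + (9 / 20) *: h_y h) &
      equ (opL C)
        (- (1 / 18) *: d_p B + (1 / 324) *: A + (1 / 30) *: fp f 2
         - (2 / 15) *: h_sq h + (1 / 5) *: ph_y_h_x h)].

Definition systemI f h A B C : Prop :=
  [/\ equ (d_p B) ((5 / 9) *: A - (2 / 9) *: mulrho (d_rho A)),
      equ (d_rho B)
        (- (1 / 72) *: d_p A - (1 / 40) *: fp f 3 - (3 / 20) *: h_y h),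
      equ (d_rho C)
        ((1 / 648) *: A - (1 / 72) *: d_p B - (1 / 90) *: fp f 2
         + (2 / 45) *: h_sq h - (1 / 15) *: ph_y_h_x h) &
      equ (d_p C)
        ((1 / 324) *: mulrho (d_p A) + (2 / 3) *: B
         + (1 / 180) *: mulrho (fp f 3) + (1 / 30) *: mulrho (h_y h))].

End Systems.

(* The formal power series \sum_(k >= 1) (a k) rho^k on U.  The coefficients
   only need the two p-derivatives that occur in the systems. *)
Definition rho_series (R : realType) (U : set 'rV[R]_3)
    (a : nat -> 'rV[R]_3 -> R) : Prop :=
  forall v, U v ->
    a 0%N v = 0 /\
    forall k, derivable (a k) v (evec R (inord 2)) /\
              derivable (pd (inord 2) (a k)) v (evec R (inord 2)).

(* Main.v *)
Require Import Defs.
From mathcomp Require Import all_boot all_order all_algebra ring lra.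
From mathcomp Require Import boolp classical_sets functions reals topology.
From mathcomp Require Import normedtype landau derive.
Set Implicit Arguments.
Unset Strict Implicit.
Unset Printing Implicit Defensive.
Import Order.TTheory GRing.Theory Num.Theory.
Import numFieldNormedType.Exports.
Local Open Scope classical_set_scope.
Local Open Scope ring_scope.

(* Series: in degree k the operator L multiplies the next coefficient by
   (k+1)(2k-3), which never vanishes, so (II) is a recursion and the first order
   equations can be checked degree by degree.  If the first equation of (I) holds
   in degree k, then so does the second; its p-derivative is the first equation
   in degree k+1.  Likewise the third equation in degree k follows from the
   fourth, and yields by p-differentiation the fourth in degree k+1.

   Functions: differentiating (I) once expresses the second derivatives of A, B
   and C; (II) then amounts to the symmetry of the mixed second derivatives of A
   and B.  A and B are only twice differentiable, not C^2, so the symmetry is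
   Young's theorem, obtained from the second difference quotient. *)

Lemma is_derive_line (R : numFieldType) (V W : normedModType R) (f : V -> W)
    (b u : V) (s : R) :
  derivable f (b + s *: u) u ->
  is_derive s 1 (fun r => f (b + r *: u)) ('D_u f (b + s *: u)).
Proof.
have E : (fun k : R => k^-1 *: (((fun r : R => f (b + r *: u)) \o shift s) (k *: 1)
    - f (b + s *: u))) =
  (fun k : R => k^-1 *: ((f \o shift (b + s *: u)) (k *: u) - f (b + s *: u))).
  apply/funext => k /=; congr (_ *: (f _ - _)).
  by rewrite [k *: _]mulr1 scalerDl addrCA.
by move=> fd; split; [rewrite /derivable E | rewrite /derive E].
Qed.

Lemma differentiable_near_le (R : numFieldType) (V W : normedModType R)
    (f : V -> W) (a : V) (e : R) : 0 < e -> differentiable f a ->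
  \forall w \near (0 : V), `|f (a + w) - f a - 'd f a w| <= e * `|w|.
Proof.
move=> e0 fa; have := diff_locally fa.
move/eqaddoE => /eqaddoP /(_ e e0).
apply: filterS => w /=.
by rewrite !fctE /= (addrC w) opprD addrA.
Qed.

Lemma second_difference (R : realType) (V : normedModType R) (f : V -> R)
    (a u v : V) (e : R) : 0 < e ->
  (\forall x \near a, derivable f x u) -> differentiable ('D_u f) a ->
  \forall t \near (0 : R)^'+,
    `|f (a + t *: v + t *: u) - f (a + t *: u) - f (a + t *: v) + f a
      - t ^+ 2 * 'D_v ('D_u f) a| <= e * t ^+ 2.
Proof.
move=> e0 fu gu.
pose g := 'D_u f; pose M := 2 * `|u| + `|v| + 1.
have M0 : 0 < M by rewrite ltr_wpDl// addr_ge0// mulr_ge0.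
pose e' := e / (2 * M).
have e'0 : 0 < e' by rewrite divr_gt0// mulr_gt0.
have /nbhs_normP[d /= d0 Hd] : \forall x \near a, derivable f x u /\
    `|g x - g a - 'd g a (x - a)| <= e' * `|x - a|.
  near=> x; split; first by near: x.
  have -> : g x = g (a + (x - a)) by rewrite addrC subrK.
  near: x; have := differentiable_near_le e'0 gu.
  move/nbhs_normP => [r /= r0 Hr]; apply/nbhs_normP; exists r => //= x xr.
  by apply: Hr; rewrite /= sub0r normrN -normrN opprB.
have bnd c t k : 0 < t -> 0 <= c <= t -> 0 <= k <= t ->
    `|k *: v + c *: u| <= t * M.
  move=> t0 /andP[c0 ct] /andP[k0 kt]; apply: (le_trans (ler_normD _ _)).
  rewrite !normrZ !ger0_norm// /M.
  have := ler_wpM2r (normr_ge0 u) ct; have := ler_wpM2r (normr_ge0 v) kt.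
  have := mulr_ge0 (ltW t0) (normr_ge0 u); lra.
near=> t.
have t0 : 0 < t by near: t; exact: nbhs_right_gt.
have td : t * M < d.
  by rewrite -ltr_pdivlMr//; near: t; apply: nbhs_right_lt; rewrite divr_gt0.
have small c k : 0 <= c <= t -> 0 <= k <= t ->
    derivable f (a + k *: v + c *: u) u /\
    `|g (a + k *: v + c *: u) - g a - 'd g a (k *: v + c *: u)| <= e' * (t * M).
  move=> ct kt; have B := bnd c t k t0 ct kt.
  have E : a + k *: v + c *: u - a = k *: v + c *: u.
    by rewrite -(addrA a) addrAC subrr add0r.
  have [] := Hd (a + k *: v + c *: u).
    by rewrite /= distrC E (le_lt_trans B).
  rewrite E => df le1; split=> //; apply: le_trans le1 _.
  by rewrite ler_wpM2l// ltW.
have tt : 0 <= t <= t by rewrite lexx ltW.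
have zt : 0 <= (0 : R) <= t by rewrite lexx ltW.
pose phi s := f (a + t *: v + s *: u) - f (a + 0 *: v + s *: u).
have dphi s : 0 <= s <= t -> is_derive s 1 phi
    (g (a + t *: v + s *: u) - g (a + 0 *: v + s *: u)).
  move=> st; have [d1 _] := small s t st tt; have [d2 _] := small s 0 st zt.
  exact: is_deriveB (is_derive_line d1) (is_derive_line d2).
have [c] : exists2 c, c \in `]0, t[ & phi t - phi 0 =
    (g (a + t *: v + c *: u) - g (a + 0 *: v + c *: u)) * (t - 0).
  apply: (@MVT R phi) => // [s|].
    by rewrite in_itv/= => /andP[s0 st]; apply: dphi; rewrite !ltW.
  apply: derivable_within_continuous => s.
  by rewrite in_itv/= => st; have [] := dphi s st.
rewrite in_itv/= => /andP[c0 ct].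
have ctI : 0 <= c <= t by rewrite !ltW.
have [_] := small c t ctI tt; have [_] := small c 0 ctI zt.
rewrite /phi !scale0r !addr0 !add0r (linearD ('d g a)).
have -> : 'd g a (t *: v) = t * 'D_v g a by rewrite deriveE// linearZ.
rewrite -/g subr0.
set d1 := 'd _ _ _; set D := 'D_v _ _.
set g1 := g _; set g2 := g (a + t *: v + _); set g0 := g a.
set f1 := f _; set f2 := f (a + t *: u); set f3 := f _.
rewrite /GRing.scale/= => l1 l2 fE.
have -> : f1 - f2 - f3 + f a - t ^+ 2 * D = (g2 - g1 - t * D) * t.
  by rewrite mulrBl -fE; ring.
rewrite normrM (gtr0_norm t0) expr2 mulrA ler_pM2r//.
have -> : e * t = e' * (t * M) + e' * (t * M).
  rewrite /e'; field; rewrite gt_eqF//.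
move: l1 l2; rewrite !ler_norml; lra.
Unshelve. all: by end_near. Qed.

Lemma derive_swap (R : realType) (V : normedModType R) (f : V -> R)
    (a u v : V) :
  (\forall x \near a, differentiable f x) ->
  differentiable ('D_u f) a -> differentiable ('D_v f) a ->
  'D_v ('D_u f) a = 'D_u ('D_v f) a.
Proof.
move=> fa fu fv; apply/eqP; rewrite -subr_eq0 -normr_le0; apply/ler_addgt0Pl => e e0.
have e20 : 0 < e / 2 by rewrite divr_gt0.
have der w : \forall x \near a, derivable f x w.
  by apply: filterS fa => x /diff_derivable.
have S1 := second_difference v e20 (der u) fu.
have S2 := second_difference u e20 (der v) fv.
have [t [[t0 H1] H2]] := filter_ex (filterI (filterI (nbhs_right_gt 0) S1) S2).
move: H1 H2; rewrite [a + t *: u + _]addrAC; move: (f _) (f _) (f _) (f a) => f1 f2 f3 f0.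
move: ('D_v _ a) ('D_u _ a) => d1 d2 H1 H2.
rewrite addr0 -(@ler_pM2r _ (t ^+ 2)) ?exprn_gt0//.
rewrite -[X in _ * X <= _](gtr0_norm (exprn_gt0 2 t0)) -normrM.
move: H1 H2; rewrite !ler_norml; lra.
Qed.

Lemma is_derive_coord (R : numFieldType) (n : nat) (i : 'I_n)
    (w u : 'rV[R]_n) : is_derive w u (fun v => v 0 i) (u 0 i).
Proof.
have d : differentiable (fun v : 'rV[R]_n => v 0 i : R) w.
  exact: differentiable_coord.
split; first exact: diff_derivable.
rewrite /derive; apply/cvg_lim => //; apply: cvg_near_cst.
near=> t.
rewrite /= !mxE /GRing.scale/= addrK mulKf//.
by near: t; exact: nbhs_dnbhs_neq.
Unshelve. all: by end_near. Qed.

Lemma is_derive_ext (R : numFieldType) (V W : normedModType R) (D : set V)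
    (f g : V -> W) (a v : V) (df : W) :
  open D -> D a -> (forall x, D x -> f x = g x) ->
  is_derive a v g df -> is_derive a v f df.
Proof.
move=> Do Da fg; apply: near_eq_is_derive.
by apply: filterS (open_nbhs_nbhs (conj Do Da)) => x /fg.
Qed.

Lemma pd_ext (R : realType) (n : nat) (U : set 'rV[R]_n) (i : 'I_n)
    (f g : 'rV[R]_n -> R) (v : 'rV[R]_n) (d : R) :
  open U -> U v -> (forall x, U x -> f x = g x) ->
  is_derive v (evec R i) g d -> pd i f v = d.
Proof. by move=> Uo Uv fg /(is_derive_ext Uo Uv fg) [_]. Qed.

Lemma forget_last_line (R : realType) (n : nat) (v u : 'rV[R]_n.+1) (t : R) :
  forget_last (t *: u + v) = t *: forget_last u + forget_last v.
Proof. by apply/rowP => i; rewrite !mxE. Qed.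

Lemma is_derive_forget_last (R : realType) (n : nat) (g : 'rV[R]_n -> R)
    (v u : 'rV[R]_n.+1) (d : R) :
  is_derive (forget_last v) (forget_last u) g d ->
  is_derive v u (g \o @forget_last R n) d.
Proof.
have E : (fun t : R => t^-1 *: (((g \o @forget_last R n) \o shift v) (t *: u)
    - (g \o @forget_last R n) v)) =
  (fun t : R => t^-1 *: ((g \o shift (forget_last v)) (t *: forget_last u)
    - g (forget_last v))).
  by apply/funext => t /=; rewrite forget_last_line.
by move=> [d1 d2]; split; [rewrite /derivable E | rewrite /derive E].
Qed.

Lemma forget_last_evec_max (R : realType) (n : nat) :
  forget_last (evec R (inord n : 'I_n.+1)) = 0.
Proof.
apply/rowP => i; rewrite !mxE/=; case: eqP => // /(congr1 val)/=.
by rewrite inordK// => iE; have := ltn_ord i; rewrite iE ltnn.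
Qed.

Lemma forget_last_evec (R : realType) (n k : nat) : (k < n.+1)%N ->
  forget_last (evec R (inord k : 'I_n.+2)) = evec R (inord k : 'I_n.+1).
Proof.
move=> kn; apply/rowP => i; rewrite !mxE/=; congr (_%:R); congr nat_of_bool.
by rewrite -!val_eqE/= !inordK// ltnW.
Qed.

Lemma foldr_nseq (S T : Type) (g : S -> T -> T) (x : T) (i : S) (k : nat) :
  foldr g x (nseq k i) = iter k (g i) x.
Proof. by elim: k => //= k ->. Qed.

Lemma is_derive_iter_pd (R : realType) (n : nat) (U : set 'rV[R]_n) (i : 'I_n)
    (f : 'rV[R]_n -> R) (k : nat) (v : 'rV[R]_n) : smooth_on U f -> U v ->
  is_derive v (evec R i) (iter k (pd i) f) (iter k.+1 (pd i) f v).
Proof.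
move=> fs Uv; apply: derivableP; apply: diff_derivable.
have := fs k.+1 (nseq k i); rewrite size_nseq foldr_nseq; exact.
Qed.

Lemma is_derive_forget_last_max (R : realType) (n : nat) (g : 'rV[R]_n -> R)
    (v : 'rV[R]_n.+1) :
  is_derive v (evec R (inord n)) (g \o @forget_last R n) 0.
Proof.
by apply: is_derive_forget_last; rewrite forget_last_evec_max; exact: is_derive0.
Qed.

Section Series.
Context (R : realType) (U : set 'rV[R]_3) (Uopen : open U).

Local Notation D := (pd (inord 2)).
Local Notation e := (evec R (inord 2 : 'I_3)).

Lemma opL_series (s : nat -> 'rV[R]_3 -> R) k v :
  @opL R (series_on U) s k v
  = k.+1%:R * (2 * k%:R - 3) * s k.+1 v - 1 / 8 * D (D (s k)) v.
Proof.
rewrite /opL /=; case: k => [|k]; rewrite !fctE /= /GRing.scale /=.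
  by rewrite (_ : (0 : _ -> R) v = 0) //; ring.
ring.
Qed.

Lemma mulrho_d_rho_series (s : nat -> 'rV[R]_3 -> R) k v :
  @mulrho R (series_on U) (@d_rho R (series_on U) s) k v = k%:R * s k v.
Proof. by case: k => [|k] //=; rewrite mul0r. Qed.

Lemma emb_series (phi : 'rV[R]_3 -> R) k v :
  @emb R (series_on U) phi k v = (k == 0)%:R * phi v.
Proof. by case: k => [|k] /=; rewrite ?mul1r ?mul0r. Qed.

Context (F : nat -> 'rV[R]_3 -> R) (hy h2 q : 'rV[R]_3 -> R).
Hypothesis dF : forall k v, U v -> is_derive v e (F k) (F k.+1 v).
Hypothesis dhy : forall v, is_derive v e hy 0.
Hypothesis dh2 : forall v, is_derive v e h2 0.
Hypothesis dq : forall v, is_derive v e q (hy v).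
Context (a b c : nat -> 'rV[R]_3 -> R).
Context (ha : rho_series U a) (hb : rho_series U b) (hc : rho_series U c).

Hypothesis IIA : forall k v, U v -> k.+1%:R * (2 * k%:R - 3) * a k.+1 v
  = 1 / 8 * D (D (a k)) v + (k == 0)%:R * (9 / 40 * F 4 v).
Hypothesis IIB : forall k v, U v -> k.+1%:R * (2 * k%:R - 3) * b k.+1 v
  = 1 / 8 * D (D (b k)) v - 1 / 36 * D (a k) v
    + (k == 0)%:R * (3 / 40 * F 3 v + 9 / 20 * hy v).
Hypothesis IIC : forall k v, U v -> k.+1%:R * (2 * k%:R - 3) * c k.+1 v
  = 1 / 8 * D (D (c k)) v - 1 / 18 * D (b k) v + 1 / 324 * a k v
    + (k == 0)%:R * (1 / 30 * F 2 v - 2 / 15 * h2 v + 1 / 5 * q v).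

Let da k v : U v -> is_derive v e (a k) (D (a k) v).
Proof. by move=> /ha[_ /(_ k)[d _]]; exact: derivableP. Qed.

Let dda k v : U v -> is_derive v e (D (a k)) (D (D (a k)) v).
Proof. by move=> /ha[_ /(_ k)[_ d]]; exact: derivableP. Qed.

Let db k v : U v -> is_derive v e (b k) (D (b k) v).
Proof. by move=> /hb[_ /(_ k)[d _]]; exact: derivableP. Qed.

Let succ_neq0 k : k.+1%:R != 0 :> R. Proof. by rewrite pnatr_eq0. Qed.

Let factor_neq0 k : 2 * k%:R - 3 != 0 :> R.
Proof.
rewrite subr_eq0 -natrM eqr_nat; apply/eqP => /(congr1 odd).
by rewrite oddM.
Qed.

Let coefI1 k := forall v, U v -> D (b k) v = (5 / 9 - 2 / 9 * k%:R) * a k v.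
Let coefI2 k := forall v, U v -> k.+1%:R * b k.+1 v
  = - (1 / 72) * D (a k) v - (k == 0)%:R * (1 / 40 * F 3 v + 3 / 20 * hy v).
Let coefI3 k := forall v, U v -> k.+1%:R * c k.+1 v
  = 1 / 648 * a k v - 1 / 72 * D (b k) v
    - (k == 0)%:R * (1 / 90 * F 2 v - 2 / 45 * h2 v + 1 / 15 * q v).
Let coefI4 k := forall v, U v -> D (c k.+1) v
  = 1 / 324 * D (a k) v + 2 / 3 * b k.+1 v
    + (k == 0)%:R * (1 / 180 * F 3 v + 1 / 30 * hy v).
(* The p-derivative of the rho^k-coefficient of the last equation of (I), in
   which the first equation of (II) has turned D (D (a k.-1)) into a multiple
   of a k. *)
Let coefDDc k := forall v, U v -> D (D (c k)) v
  = 8 / 324 * k%:R * (2 * k%:R - 5) * a k v + 2 / 3 * D (b k) v.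

Let coefI1_I2 k : coefI1 k -> coefI2 k.
Proof.
move=> I1 v Uv; apply: (mulfI (factor_neq0 k)).
rewrite mulrCA mulrA IIB//.
rewrite (pd_ext Uopen Uv I1 (is_deriveZ (5 / 9 - 2 / 9 * k%:R) (da k Uv))).
by rewrite /GRing.scale/=; case: k {I1} => [|k] /=; field.
Qed.

Let coefI2_I1S k : coefI2 k -> coefI1 k.+1.
Proof.
move=> I2 v Uv.
have I2' x : U x -> b k.+1 x = k.+1%:R^-1 * (- (1 / 72) * D (a k) x
    - (k == 0)%:R * (1 / 40 * F 3 x + 3 / 20 * hy x)).
  by move=> Ux; rewrite -I2// mulKf.
have dI2 := is_deriveZ k.+1%:R^-1
  (is_deriveB (is_deriveZ (- (1 / 72)) (dda k Uv)) (is_deriveZ (k == 0)%:R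
    (is_deriveD (is_deriveZ (1 / 40) (dF 3 Uv)) (is_deriveZ (3 / 20) (dhy v))))).
rewrite (pd_ext Uopen Uv I2' dI2).
apply: (mulfI (succ_neq0 k)); apply: (mulfI (factor_neq0 k)).
rewrite [X in _ * X]mulVKf//.
transitivity ((5 / 9 - 2 / 9 * k.+1%:R)
    * (k.+1%:R * (2 * k%:R - 3) * a k.+1 v)); last by ring.
rewrite IIA// /GRing.scale/=.
by case: k {I2 I2' dI2} => [|k]/=; field.
Qed.

Let coefDDc_I3 k : coefI1 k -> coefDDc k -> coefI3 k.
Proof.
move=> I1 ddc v Uv; apply: (mulfI (factor_neq0 k)).
rewrite mulrCA mulrA IIC// ddc// I1//.
by case: k {I1 ddc} => [|k]/=; field.
Qed.

Let coefI3_I4 k : coefI1 k -> coefI2 k -> coefI3 k -> coefI4 k.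
Proof.
move=> I1 I2 I3 v Uv.
have I3' x : U x -> c k.+1 x = k.+1%:R^-1 * (1 / 648 * a k x
    - 1 / 72 * ((5 / 9 - 2 / 9 * k%:R) * a k x)
    - (k == 0)%:R * (1 / 90 * F 2 x - 2 / 45 * h2 x + 1 / 15 * q x)).
  by move=> Ux; rewrite -I1// -I3// mulKf.
have dI3 := is_deriveZ k.+1%:R^-1 (is_deriveB
  (is_deriveB (is_deriveZ (1 / 648) (da k Uv)) (is_deriveZ (1 / 72)
    (is_deriveZ (5 / 9 - 2 / 9 * k%:R) (da k Uv))))
  (is_deriveZ (k == 0)%:R (is_deriveD
    (is_deriveB (is_deriveZ (1 / 90) (dF 2 Uv)) (is_deriveZ (2 / 45) (dh2 v)))
    (is_deriveZ (1 / 15) (dq v))))).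
rewrite (pd_ext Uopen Uv I3' dI3).
apply: (mulfI (succ_neq0 k)); rewrite [LHS]mulVKf//.
transitivity (k.+1%:R * (1 / 324 * D (a k) v
    + (k == 0)%:R * (1 / 180 * F 3 v + 1 / 30 * hy v))
  + 2 / 3 * (k.+1%:R * b k.+1 v)); last by ring.
rewrite I2// /GRing.scale/=.
by case: k {I1 I2 I3 I3' dI3} => [|k]/=; field.
Qed.

Let coefI4_DDc k : coefI4 k -> coefDDc k.+1.
Proof.
move=> I4 v Uv.
have dI4 := is_deriveD
  (is_deriveD (is_deriveZ (1 / 324) (dda k Uv)) (is_deriveZ (2 / 3) (db k.+1 Uv)))
  (is_deriveZ (k == 0)%:R
    (is_deriveD (is_deriveZ (1 / 180) (dF 3 Uv)) (is_deriveZ (1 / 30) (dhy v)))).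
rewrite (pd_ext Uopen Uv I4 dI4) /GRing.scale/=.
have := IIA k Uv; rewrite -natr1.
by case: k {I4 dI4} => [|k]/=; lra.
Qed.

Let rho_series_pd0 s v : rho_series U s -> U v -> D (s 0%N) v = 0.
Proof.
move=> hs Uv; apply: (pd_ext (g := cst 0) Uopen Uv) => x Ux.
by have [-> _] := hs x Ux.
Qed.

Let coefI1_DDc k : coefI1 k /\ coefDDc k.
Proof.
elim: k => [|k [I1 ddc]].
  split=> v Uv; have [a0 _] := ha Uv; rewrite rho_series_pd0// a0 ?mulr0 ?add0r//.
  apply: (pd_ext (g := cst 0) Uopen Uv) => x Ux.
  exact: rho_series_pd0.
have I2 := coefI1_I2 I1; split; first exact: coefI2_I1S.
by apply: coefI4_DDc; apply: coefI3_I4 => //; exact: coefDDc_I3.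
Qed.

Lemma series_II_I1 k v : U v -> D (b k) v = (5 / 9 - 2 / 9 * k%:R) * a k v.
Proof. by have [I1 _] := coefI1_DDc k; exact: I1. Qed.

Lemma series_II_I2 k v : U v -> k.+1%:R * b k.+1 v
  = - (1 / 72) * D (a k) v - (k == 0)%:R * (1 / 40 * F 3 v + 3 / 20 * hy v).
Proof. by have [I1 _] := coefI1_DDc k; exact: coefI1_I2. Qed.

Lemma series_II_I3 k v : U v -> k.+1%:R * c k.+1 v
  = 1 / 648 * a k v - 1 / 72 * D (b k) v
    - (k == 0)%:R * (1 / 90 * F 2 v - 2 / 45 * h2 v + 1 / 15 * q v).
Proof. by have [I1 ddc] := coefI1_DDc k; exact: coefDDc_I3. Qed.

Lemma series_II_I4_0 v : U v -> D (c 0%N) v = 0.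
Proof. exact: rho_series_pd0. Qed.

Lemma series_II_I4S k v : U v -> D (c k.+1) v
  = 1 / 324 * D (a k) v + 2 / 3 * b k.+1 v
    + (k == 0)%:R * (1 / 180 * F 3 v + 1 / 30 * hy v).
Proof.
by have [I1 _] := coefI1_DDc k; apply: coefI3_I4 => //;
  [exact: series_II_I2|exact: series_II_I3].
Qed.

End Series.

Section Functions.
Context (R : realType) (U : set 'rV[R]_3) (F : nat -> 'rV[R]_3 -> R).
Context (hy h2 q : 'rV[R]_3 -> R).
Hypothesis dF : forall k v, U v -> is_derive v (evec R (inord 2)) (F k) (F k.+1 v).
Hypothesis dhy : forall v, is_derive v (evec R (inord 2)) hy 0.
Context (W : set 'rV[R]_4) (Wopen : open W).
Context (WU : forall w, W w -> U (forget_last w)).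
Context (A B C : 'rV[R]_4 -> R).
Context (hA : differentiable_upto 2 W A) (hB : differentiable_upto 2 W B).

Local Notation p := (inord 2 : 'I_4).
Local Notation r := (inord 3 : 'I_4).
Local Notation Dp := (pd p).
Local Notation Dr := (pd r).
Local Notation ep := (evec R p).
Local Notation er := (evec R r).
Local Notation up phi := (phi \o @forget_last R 3).

Let rho (w : 'rV[R]_4) : R := w 0 r.

Let is_derive_upto2 g i w : differentiable_upto 2 W g -> W w ->
  is_derive w (evec R i) g (pd i g w).
Proof.
by move=> hg Ww; apply: derivableP; apply: diff_derivable; exact: (hg [::]).
Qed.

Let is_derive_pd_upto2 g i j w : differentiable_upto 2 W g -> W w ->
  is_derive w (evec R j) (pd i g) (pd j (pd i g) w).
Proof.
move=> hg Ww; apply: derivableP; apply: diff_derivable.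
exact: (hg [:: i]).
Qed.

Let pd_swap g w : differentiable_upto 2 W g -> W w ->
  Dp (Dr g) w = Dr (Dp g) w.
Proof.
move=> hg Ww; apply: derive_swap; last exact: (hg [:: p]).
  by apply: filterS (open_nbhs_nbhs (conj Wopen Ww)) => x; exact: (hg [::]).
exact: (hg [:: r]).
Qed.

Let drho_p w : is_derive w ep rho 0.
Proof.
have -> : 0 = ep 0 r; last exact: is_derive_coord.
by rewrite mxE -!val_eqE/= !inordK.
Qed.

Let drho_r w : is_derive w er rho 1.
Proof.
have -> : 1 = er 0 r; last exact: is_derive_coord.
by rewrite mxE !eqxx.
Qed.

Let dup_r (phi : 'rV[R]_3 -> R) w : is_derive w er (up phi) 0.
Proof. exact: is_derive_forget_last_max. Qed.

Let dup_p (phi : 'rV[R]_3 -> R) w (d : R) : is_derive (forget_last w) (evec R (inord 2)) phi d ->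
  is_derive w ep (up phi) d.
Proof. by move=> H; apply: is_derive_forget_last; rewrite forget_last_evec. Qed.

Let dF_p k w : W w -> is_derive w ep (up (F k)) (up (F k.+1) w).
Proof. by move=> Ww; apply: dup_p; exact: dF (WU Ww). Qed.

Let dhy_p w : is_derive w ep (up hy) 0.
Proof. by exact: dup_p. Qed.

Hypothesis I1 : forall w, W w ->
  Dp B w = 5 / 9 * A w - 2 / 9 * (rho w * Dr A w).
Hypothesis I2 : forall w, W w -> Dr B w
  = - (1 / 72) * Dp A w - 1 / 40 * up (F 3) w - 3 / 20 * up hy w.
Hypothesis I3 : forall w, W w -> Dr C w
  = 1 / 648 * A w - 1 / 72 * Dp B w - 1 / 90 * up (F 2) w + 2 / 45 * up h2 w
    - 1 / 15 * up q w.
Hypothesis I4 : forall w, W w -> Dp C w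
  = 1 / 324 * (rho w * Dp A w) + 2 / 3 * B w + 1 / 180 * (rho w * up (F 3) w)
    + 1 / 30 * (rho w * up hy w).

Let DrDpB w : W w ->
  Dr (Dp B) w = 1 / 3 * Dr A w - 2 / 9 * (rho w * Dr (Dr A) w).
Proof.
move=> Ww.
have dI := is_deriveB (is_deriveZ (5 / 9) (is_derive_upto2 r hA Ww))
  (is_deriveZ (2 / 9) (is_deriveM (drho_r w) (is_derive_pd_upto2 r r hA Ww))).
rewrite (pd_ext Wopen Ww I1 dI).
move: (Dr (Dr A) w) (Dr A w) => *.
by rewrite /GRing.scale/=; field.
Qed.

Let DpDpB w : W w ->
  Dp (Dp B) w = 5 / 9 * Dp A w - 2 / 9 * (rho w * Dp (Dr A) w).
Proof.
move=> Ww.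
have dI := is_deriveB (is_deriveZ (5 / 9) (is_derive_upto2 p hA Ww))
  (is_deriveZ (2 / 9) (is_deriveM (drho_p w) (is_derive_pd_upto2 r p hA Ww))).
rewrite (pd_ext Wopen Ww I1 dI).
move: (Dp (Dr A) w) (Dp A w) (Dr A w) => *.
by rewrite /GRing.scale/=; ring.
Qed.

Let DpDrB w : W w ->
  Dp (Dr B) w = - (1 / 72) * Dp (Dp A) w - 1 / 40 * up (F 4) w.
Proof.
move=> Ww.
have dI := is_deriveB
  (is_deriveB (is_deriveZ (- (1 / 72)) (is_derive_pd_upto2 p p hA Ww))
    (is_deriveZ (1 / 40) (dF_p 3 Ww)))
  (is_deriveZ (3 / 20) (dhy_p w)).
rewrite (pd_ext Wopen Ww I2 dI).
move: (Dp (Dp A) w) (up (F 4) w) => *.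
by rewrite /GRing.scale/=; ring.
Qed.

Let DrDrB w : W w -> Dr (Dr B) w = - (1 / 72) * Dr (Dp A) w.
Proof.
move=> Ww.
have dI := is_deriveB
  (is_deriveB (is_deriveZ (- (1 / 72)) (is_derive_pd_upto2 p r hA Ww))
    (is_deriveZ (1 / 40) (dup_r (F 3) w)))
  (is_deriveZ (3 / 20) (dup_r hy w)).
rewrite (pd_ext Wopen Ww I2 dI).
move: (Dr (Dp A) w) => *.
by rewrite /GRing.scale/=; ring.
Qed.

Let DrDrC w : W w ->
  Dr (Dr C) w = 1 / 648 * Dr A w - 1 / 72 * Dr (Dp B) w.
Proof.
move=> Ww.
have dI := is_deriveB (is_deriveD
    (is_deriveB (is_deriveB (is_deriveZ (1 / 648) (is_derive_upto2 r hA Ww))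
      (is_deriveZ (1 / 72) (is_derive_pd_upto2 p r hB Ww)))
    (is_deriveZ (1 / 90) (dup_r (F 2) w)))
  (is_deriveZ (2 / 45) (dup_r h2 w)))
  (is_deriveZ (1 / 15) (dup_r q w)).
rewrite (pd_ext Wopen Ww I3 dI).
move: (Dr (Dp B) w) (Dr A w) => *.
by rewrite /GRing.scale/=; ring.
Qed.

Let DpDpC w : W w -> Dp (Dp C) w
  = 1 / 324 * (rho w * Dp (Dp A) w) + 2 / 3 * Dp B w
    + 1 / 180 * (rho w * up (F 4) w).
Proof.
move=> Ww.
have dI := is_deriveD (is_deriveD (is_deriveD
    (is_deriveZ (1 / 324)
      (is_deriveM (drho_p w) (is_derive_pd_upto2 p p hA Ww)))
    (is_deriveZ (2 / 3) (is_derive_upto2 p hB Ww)))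
  (is_deriveZ (1 / 180) (is_deriveM (drho_p w) (dF_p 3 Ww))))
  (is_deriveZ (1 / 30) (is_deriveM (drho_p w) (dhy_p w))).
rewrite (pd_ext Wopen Ww I4 dI).
move: (Dp (Dp A) w) (Dp A w) (Dp B w) (up (F 4) w) (up (F 3) w) (up hy w) => *.
by rewrite /GRing.scale/=; ring.
Qed.

Lemma functions_I_IIA w : W w ->
  2 * (rho w * Dr (Dr A) w) - 3 * Dr A w - 1 / 8 * Dp (Dp A) w
  = 9 / 40 * up (F 4) w.
Proof.
move=> Ww; have := pd_swap hB Ww; rewrite DpDrB// DrDpB//.
by move: (Dp _ w) (Dr A w) (Dr _ w) (up _ w) => *; lra.
Qed.

Lemma functions_I_IIB w : W w ->
  2 * (rho w * Dr (Dr B) w) - 3 * Dr B w - 1 / 8 * Dp (Dp B) w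
  = - (1 / 36) * Dp A w + 3 / 40 * up (F 3) w + 9 / 20 * up hy w.
Proof.
move=> Ww; rewrite DrDrB// DpDpB// I2// -pd_swap//.
by move: (Dp (Dr _) w) (Dp A w) (up hy w) (up _ w) => *; field.
Qed.

Lemma functions_I_IIC w : W w ->
  2 * (rho w * Dr (Dr C) w) - 3 * Dr C w - 1 / 8 * Dp (Dp C) w
  = - (1 / 18) * Dp B w + 1 / 324 * A w + 1 / 30 * up (F 2) w
    - 2 / 15 * up h2 w + 1 / 5 * up q w.
Proof.
move=> Ww; rewrite DrDrC// DpDpC// I3// -pd_swap// DpDrB// I1//.
move: (Dp (Dp A) w) (Dr A w) (up (F 4) w) (up (F 2) w).
by move: (up h2 w) (up q w) => *; field.
Qed.

End Functions.

Theorem theorem3p3 (R : realType)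
    (U : set 'rV[R]_3) (V : set 'rV[R]_2)
    (Uopen : open U) (Vopen : open V)
    (UV : forall v, U v -> V (forget_last v))
    (f : 'rV[R]_3 -> R) (h : 'rV[R]_2 -> R)
    (fsmooth : smooth_on U f) (hsmooth : smooth_on V h) :
  (forall a b c : nat -> 'rV[R]_3 -> R,
     rho_series U a -> rho_series U b -> rho_series U c ->
     @systemII R (series_on U) f h a b c ->
     @systemI R (series_on U) f h a b c) /\
  (forall W : set 'rV[R]_4, open W ->
     (forall w, W w -> U (forget_last w)) ->
   forall A B C : 'rV[R]_4 -> R,
     differentiable_upto 2 W A -> differentiable_upto 2 W B ->
     differentiable_upto 2 W C ->
     @systemI R (functions_on W) f h A B C ->
     @systemII R (functions_on W) f h A B C).
Proof.
pose F k := iter k (pd (inord 2)) f.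
pose hy := pd (inord 1) h \o @forget_last R 2.
pose hx := pd (inord 0) h \o @forget_last R 2.
pose h2 := (fun u => h u ^+ 2) \o @forget_last R 2.
pose q (v : 'rV[R]_3) := v 0 (inord 2) * hy v + hx v.
have dF k v : U v -> is_derive v (evec R (inord 2)) (F k) (F k.+1 v).
  exact: is_derive_iter_pd.
have dhy v : is_derive v (evec R (inord 2)) hy 0.
  exact: is_derive_forget_last_max.
have dhx v : is_derive v (evec R (inord 2)) hx 0.
  exact: is_derive_forget_last_max.
have dh2 v : is_derive v (evec R (inord 2)) h2 0.
  exact: is_derive_forget_last_max.
have dq v : is_derive v (evec R (inord 2)) q (hy v).
  have dp := is_derive_coord (inord 2) v (evec R (inord 2)).
  apply: is_derive_eq (is_deriveD (is_deriveM dp (dhy v)) (dhx v)) _.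
  by rewrite mxE !eqxx /GRing.scale/=; ring.
split=> [a b c ha hb hc [IIA IIB IIC] | W Wo WU A B C hA hB hC [I1 I2 I3 I4]].
  have {}IIA k v : U v -> k.+1%:R * (2 * k%:R - 3) * a k.+1 v
      = 1 / 8 * pd (inord 2) (pd (inord 2) (a k)) v
        + (k == 0)%:R * (9 / 40 * F 4 v).
    move=> Uv; have {IIA} : @opL R (series_on U) a k v
      = 9 / 40 * @emb R (series_on U) (F 4) k v by exact: IIA.
    by rewrite opL_series emb_series; move: (F 4) => *; lra.
  have {}IIB k v : U v -> k.+1%:R * (2 * k%:R - 3) * b k.+1 v
      = 1 / 8 * pd (inord 2) (pd (inord 2) (b k)) v - 1 / 36 * pd (inord 2) (a k) v
        + (k == 0)%:R * (3 / 40 * F 3 v + 9 / 20 * hy v).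
    move=> Uv; have {IIB} : @opL R (series_on U) b k v
      = - (1 / 36) * pd (inord 2) (a k) v
        + 3 / 40 * @emb R (series_on U) (F 3) k v
        + 9 / 20 * @emb R (series_on U) hy k v by exact: IIB.
    by rewrite opL_series !emb_series; move: (F 3) (hy) => *; lra.
  have {}IIC k v : U v -> k.+1%:R * (2 * k%:R - 3) * c k.+1 v
      = 1 / 8 * pd (inord 2) (pd (inord 2) (c k)) v - 1 / 18 * pd (inord 2) (b k) v
        + 1 / 324 * a k v
        + (k == 0)%:R * (1 / 30 * F 2 v - 2 / 15 * h2 v + 1 / 5 * q v).
    move=> Uv; have {IIC} : @opL R (series_on U) c k v
      = - (1 / 18) * pd (inord 2) (b k) v + 1 / 324 * a k v
        + 1 / 30 * @emb R (series_on U) (F 2) k v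
        - 2 / 15 * @emb R (series_on U) h2 k v
        + 1 / 5 * @emb R (series_on U) q k v by exact: IIC.
    by rewrite opL_series !emb_series; move: (F 2) (h2) (q) => *; lra.
  have S1 := series_II_I1 Uopen dF dhy dh2 dq ha hb hc IIA IIB IIC.
  have S2 := series_II_I2 Uopen dF dhy dh2 dq ha hb hc IIA IIB IIC.
  have S3 := series_II_I3 Uopen dF dhy dh2 dq ha hb hc IIA IIB IIC.
  have S4 := series_II_I4S Uopen dF dhy dh2 dq ha hb hc IIA IIB IIC.
  split=> k v Uv.
  - change (pd (inord 2) (b k) v = 5 / 9 * a k v - 2 / 9
      * @mulrho R (series_on U) (@d_rho R (series_on U) a) k v).
    by apply: (etrans (S1 k v Uv)); rewrite mulrho_d_rho_series; ring.
  - change (k.+1%:R * b k.+1 v = - (1 / 72) * pd (inord 2) (a k) v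
      - 1 / 40 * @emb R (series_on U) (F 3) k v
      - 3 / 20 * @emb R (series_on U) hy k v).
    apply: (etrans (S2 k v Uv)); rewrite !emb_series.
    by move: (F 3) (hy) => *; ring.
  - change (k.+1%:R * c k.+1 v = 1 / 648 * a k v - 1 / 72 * pd (inord 2) (b k) v
      - 1 / 90 * @emb R (series_on U) (F 2) k v
      + 2 / 45 * @emb R (series_on U) h2 k v
      - 1 / 15 * @emb R (series_on U) q k v).
    apply: (etrans (S3 k v Uv)); rewrite !emb_series.
    by move: (F 2) (h2) (q) => *; ring.
  case: k => [|k].
    change (pd (inord 2) (c 0%N) v
      = 1 / 324 * 0 + 2 / 3 * b 0%N v + 1 / 180 * 0 + 1 / 30 * 0).
    have [-> _] := hb v Uv.
    by rewrite (series_II_I4_0 Uopen hc Uv) !mulr0 !addr0.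
  change (pd (inord 2) (c k.+1) v
    = 1 / 324 * pd (inord 2) (a k) v + 2 / 3 * b k.+1 v
      + 1 / 180 * @emb R (series_on U) (F 3) k v
      + 1 / 30 * @emb R (series_on U) hy k v).
  apply: (etrans (S4 k v Uv)); rewrite !emb_series.
  by move: (F 3) (hy) => *; ring.
split=> w Ww.
- exact: (functions_I_IIA dF dhy Wo WU hA hB I1 I2 Ww).
- exact: (functions_I_IIB (F := F) (hy := hy) Wo hA I1 I2 Ww).
exact: (functions_I_IIC (h2 := h2) (q := q) dF dhy Wo WU hA hB I1 I2 I3 I4 Ww).
Qed.
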